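(* There are absolute constants $c_1,c_2>0$ such that the following holds. Let $k\ge1$ be an integer, $\varepsilon\in(0,1)$, $\alpha,\beta\ge0$, $C(L,T)=\alpha L+\beta T$, and suppose $m\ge n\ge c_1\frac{k}{\varepsilon}$. Then for the D-CPPG with objective $C$ a mixed discrete up-and-down path provides a $\big(\frac{11}{10}+O(\varepsilon)\big)$-approximate solution: there is a mixed discrete up-and-down path which is a covering path and whose path length $L'$ and stop count $T'$ satisfy $C(L',T')\le\big(\frac{11}{10}+c_2\varepsilon\big)C(L,T)$ for every covering path with path length $L$ and stop count $T$.
   Context: Let $m\ge n\ge 1$ be integers, $D=\{(x,y)\in\mathbb{R}^2: 0\le x\le n,\ 0\le y\le m\}$, $D_{int}=D\cap\mathbb{Z}^2$. Distances are $\ell_1$ distances. D-CPPG with integer coverage radius $k$: a covering path is a finite sequence $F_1,\dots,F_T$ of distinct points of $D_{int}$ (stops) such that every point of $D_{int}$ is within $\ell_1$ distance $k$ of some $F_i$; its stop count is $T$ and its path length is $\sum_{i}\|F_{i+1}-F_i\|_1$ (or the length of a prescribed path visiting the stops in this order). The problem is to minimize $C(\text{path length},\text{stop count})$ over covering paths. Discrete up-and-down paths on a rectangle $R$ of integer width $w$ and height $m$ (lower left corner at the origin after translation), for $d\in\{1,2,4,\dots,2k,2k+1\}$: (i) For $d=1$ put $r=2k+1$; for even $d$ put $r=2k+1-\frac d2$. There are vertical traversals from height $0$ to $m$ at $x=0,r,2r,\dots,\lfloor w/r\rfloor r$ and, if $w/r$ is not an integer, at $x=w$; the path goes up the first, along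 the top side to the second, down the second, along the bottom side to the third, and so on. For $d=1$ every integer point of each traversal is a stop. For even $d$, the 1st, 3rd, ... traversals have stops at heights $jd\le m$, the 2nd, 4th, ... at heights $jd+\frac d2\le m$ ($j=0,1,\dots$), and every traversal has a stop at height $m$. (ii) Type-$(2k+1)$ (zigzag path): let $\mathbb{A}=\{(a,b)\in\mathbb{Z}^2:\frac{ka+(k+1)b}{2k^2+2k+1}\in\mathbb{Z}\}$ and let $\mathbb{A}_1$ be the set of those $(a,b)\in\mathbb{A}$ for which some integer point of $R$ is within $\ell_1$ distance $k$ of $(a,b)$. Traversal $i$ consists of the $(a,b)\in\mathbb{A}_1$ with $\frac{ka+(k+1)b}{2k^2+2k+1}=i$, in their order along this line; the traversals are visited in order of $i$ in alternating directions (up-and-down fashion). Every point of $\mathbb{A}_1$ outside $R$ is replaced by its projection onto $R$ (nearest point of $R$), the resulting points being the stops, and consecutive stops are connected along grid lines (by shortest grid paths). Mixed discrete up-and-down path: for $d_1,d_2$ consecutive in the list $1,2,4,\dots,2k-2,2k,2k+1$ and $\gamma\in[0,1]$, split $D$ into a left rectangle of width $\gamma n$ and a right rectangle of width $(1-\gamma)n$, both of height $m$ (widths rounded up to integers, so that the two may overlap in a strip of width 1), cover the left one by a type-$d_1$ and the right one by a type-$d_2$ discrete up-and-down path (either part may be absent if its width is $0$), and connect the two paths by a segment at the common boundary. *)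

(* Defs.v *)
From mathcomp Require Import all_boot all_order all_algebra.
From mathcomp Require Import reals.

Set Implicit Arguments.
Unset Strict Implicit.
Unset Printing Implicit Defensive.

Import Order.TTheory GRing.Theory Num.Theory.
Local Open Scope ring_scope.

Definition point : Type := (int * int)%type.

Definition l1dist (p q : point) : nat :=
  (absz (p.1 - q.1)%R + absz (p.2 - q.2)%R)%N.

Definition in_rect (w h : nat) (p : point) : bool :=
  (0 <= p.1 <= w%:Z) && (0 <= p.2 <= h%:Z).

Definition rect_points (w h : nat) : seq point :=
  [seq (x%:Z, y%:Z) | x <- iota 0 w.+1, y <- iota 0 h.+1].

(* A path together with its stops.  [route] lists the successive waypoints,
   which are joined by shortest grid paths; the stops are visited in the
   order of [stops], but not every waypoint has to be a stop.  Taking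
   [route] equal to [stops] gives the shortest path through the stops. *)
Record tour := Tour { route : seq point; stops : seq point }.

Definition route_length (s : seq point) : nat :=
  sumn (pairmap l1dist (head (0, 0) s) s).

Definition path_length (P : tour) : nat := route_length (route P).

Definition stop_count (P : tour) : nat := size (stops P).

Definition covering_path (n m k : nat) (P : tour) : Prop :=
  [/\ uniq (stops P),
      all (in_rect n m) (route P),
      subseq (stops P) (route P)
    & forall p, in_rect n m p ->
        exists2 F, F \in stops P & (l1dist p F <= k)%N].

Definition cost (R : realType) (alpha beta : R) (L T : nat) : R :=
  alpha * L%:R + beta * T%:R.

(* The members of [ts] are listed upwards; they are concatenated after
   reversing every other one, the first one being reversed iff [down]. *)
Fixpoint alternate (down : bool) (ts : seq (seq point)) : seq point :=
  if ts is t :: ts' then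
    (if down then rev t else t) ++ alternate (~~ down) ts'
  else [::].

(* For d = 1 or d even.  Since 1./2 = 0, the expression
   2k + 1 - d./2 also gives the spacing 2k + 1 prescribed for d = 1. *)
Definition spacing (k d : nat) : nat := (k.*2.+1 - d./2)%N.

(* The traversals are at 0, r, ..., (w %/ r) * r and, if r does not divide w,
   at w; the i-th abscissa (from 0) is therefore minn (i * r) w. *)
Definition traversal_count (r w : nat) : nat := (w %/ r + ~~ (r %| w)).+1%N.

Definition traversal_x (r w i : nat) : nat := minn (i * r) w.

(* For y : nat and d even, y = d./2 modulo d means y = j * d + d./2 with
   j >= 0.  For d = 1 every height is a stop. *)
Definition stop_height (d h i y : nat) : bool :=
  (y == (if odd i then d./2 else 0) %[mod d])%N || (y == h).

Definition vertical_path (k d w h : nat) : tour :=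
  let r := spacing k d in
  let column (a : pred nat) i :=
    [seq ((traversal_x r w i)%:Z, y%:Z) : point | y <- iota 0 h.+1 & a y] in
  Tour
    (alternate false (mkseq (fun i => column predT i) (traversal_count r w)))
    (alternate false
      (mkseq (fun i => column (stop_height d h i) i) (traversal_count r w))).

Definition zz_form (k : nat) (p : point) : int :=
  k%:Z * p.1 + k.+1%:Z * p.2.

Definition zz_modulus (k : nat) : int := (2 * k ^ 2 + 2 * k + 1)%N%:Z.

Definition zz_lattice (k : nat) (p : point) : bool :=
  (zz_modulus k %| zz_form k p)%Z.

Definition zz_index (k : nat) (p : point) : int :=
  (zz_form k p %/ zz_modulus k)%Z.

(* The lattice points within distance k of an integer point of the rectangle
   lie in the enclosing box [-k, w + k] x [-k, h + k]. *)
Definition zz_points (k w h : nat) : seq point :=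
  [seq p <- [seq (x%:Z - k%:Z, y%:Z - k%:Z) |
               x <- iota 0 (w + k.*2).+1, y <- iota 0 (h + k.*2).+1]
     | zz_lattice k p
         && has (fun q => l1dist q p <= k)%N (rect_points w h)].

Definition zz_traversal (k w h : nat) (i : int) : seq point :=
  sort (fun p q : point => p.2 <= q.2)
    [seq p <- zz_points k w h | zz_index k p == i].

Definition project (w h : nat) (p : point) : point :=
  (Num.max 0 (Num.min p.1 w%:Z), Num.max 0 (Num.min p.2 h%:Z)).

Definition zigzag_path (k w h : nat) : tour :=
  let indices :=
    sort <=%R (undup [seq zz_index k p | p <- zz_points k w h]) in
  let s := [seq project w h p |
              p <- alternate false [seq zz_traversal k w h i | i <- indices]] in
  Tour s s.

Definition up_and_down_path (k d w h : nat) : tour :=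
  if d == k.*2.+1 then zigzag_path k w h else vertical_path k d w h.

Definition types (k : nat) : seq nat :=
  1%N :: rcons [seq j.*2 | j <- iota 1 k] k.*2.+1.

Definition translate_x (a : int) (s : seq point) : seq point :=
  [seq (p.1 + a, p.2) | p <- s].

Definition part (k d w h : nat) (a : int) : tour :=
  if w == 0%N then Tour [::] [::]
  else let P := up_and_down_path k d w h in
       Tour (translate_x a (route P)) (translate_x a (stops P)).

(* Joining the routes adds the segment from the end of the left path to the
   start of the right one.  Both parts may stop at the same point of the common
   boundary or of the overlap; such a point is only one stop of the result. *)
Definition mixed_path (R : realType) (n m k d1 d2 : nat) (gamma : R) : tour :=
  let wl := absz (Num.ceil (gamma * n%:R)) in
  let wr := absz (Num.ceil ((1 - gamma) * n%:R)) in
  let Pl := part k d1 wl m 0 in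
  let Pr := part k d2 wr m (n%:Z - wr%:Z) in
  Tour (route Pl ++ route Pr) (undup (stops Pl ++ stops Pr)).

Definition is_mixed_path (R : realType) (n m k : nat) (P : tour) : Prop :=
  exists (d1 d2 : nat) (gamma : R),
    [/\ infix [:: d1; d2] (types k), 0 <= gamma <= 1
      & P = mixed_path n m k d1 d2 gamma].

(* Main.v *)
(* The objective is linear, so no genuine mixture is needed: a single type, namely
   the one of least cost per covered point, already suffices.

   Let M = 2 k^2 + 2 k + 1 be the size of an l1 ball of radius k.  Moving from one
   stop to another at distance d covers at most g(d) = d (2 k + 1) - floor (d^2 / 2)
   new points if d <= 2 k + 1, and at most M = g(2 k + 1) in any case.  A path of
   type d covers, up to boundary effects of relative order k / n, exactly g(d)
   points per stop at a cost alpha d + beta.  Hence the best type is optimal up to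
   the step lengths that are not types, the odd d with 1 < d < 2 k + 1; there g(d)
   exceeds the mean of g(d - 1) and g(d + 1) by 1 while g(d) >= 11, which costs the
   factor 11/10.

   The zigzag path is governed by the perfect code formed by the lattice
   k x + (k + 1) y = 0 mod M: the balls of radius k about its points are disjoint,
   which bounds the number of stops, and cover the grid. *)

Require Import Defs.
From mathcomp Require Import all_boot all_order all_algebra.
From mathcomp Require Import reals.
From mathcomp Require Import zify ring lra.

Set Implicit Arguments.
Unset Strict Implicit.
Unset Printing Implicit Defensive.

Import Order.TTheory GRing.Theory Num.Theory.
Local Open Scope ring_scope.

(** * Grid distance and projection *)

Lemma l1dist_triangle (q p r : point) : (l1dist p r <= l1dist p q + l1dist q r)%N.
Proof. rewrite /l1dist; lia. Qed.

Lemma l1dist_sym (p q : point) : l1dist p q = l1dist q p.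
Proof. rewrite /l1dist; lia. Qed.

Lemma l1dist_self (p : point) : l1dist p p = 0%N.
Proof. rewrite /l1dist; lia. Qed.

Lemma project_contract (w h : nat) (p q : point) :
  (l1dist (project w h p) (project w h q) <= l1dist p q)%N.
Proof. rewrite /project /l1dist /=; lia. Qed.

Lemma project_in_rect (w h : nat) (p : point) : in_rect w h (project w h p).
Proof. rewrite /project /in_rect /=; lia. Qed.

Lemma project_id (w h : nat) (p : point) : in_rect w h p -> project w h p = p.
Proof. case: p => a b; rewrite /project /in_rect /= => H; congr pair; lia. Qed.

(** * Lengths of concatenated routes *)

Local Notation walk x s := (sumn (pairmap l1dist x s)).

Lemma walk_cat x s t : walk x (s ++ t) = (walk x s + walk (last x s) t)%N.
Proof. by rewrite pairmap_cat sumn_cat. Qed.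

Lemma route_length_cons x s : route_length (x :: s) = walk x s.
Proof. by rewrite /route_length /= l1dist_self. Qed.

Lemma route_length_le_walk x s : (route_length s <= walk x s)%N.
Proof. by case: s => [//|y s]; rewrite route_length_cons /= leq_addl. Qed.

Lemma walk_subseq x s t : subseq s t -> (walk x s <= walk x t)%N.
Proof.
elim: t x s => [|b t IHt] x [|a s] //=; case: eqP => [-> /IHt h|_ /(IHt b) /= h].
  by rewrite leq_add2l.
have := l1dist_triangle b x a; lia.
Qed.

(** By the triangle inequality a skipped waypoint saves length. This lets [path_length], measured
    along the route, control the distances between consecutive stops. *)
Lemma route_length_subseq s t : subseq s t -> (route_length s <= route_length t)%N.
Proof.
case: t => [|b t]; first by move/eqP => ->.
case: s => [//|a s] /=; rewrite !route_length_cons; case: eqP => [->|_ h].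
  exact: walk_subseq.
rewrite -route_length_cons.
exact: leq_trans (route_length_le_walk b _) (walk_subseq b h).
Qed.

Lemma route_length_cat p s t : s != [::] -> t != [::] ->
  route_length (s ++ t)
  = (route_length s + l1dist (last p s) (head p t) + route_length t)%N.
Proof.
case: s t => [//|x s] [//|y t] _ _.
by rewrite cat_cons !route_length_cons walk_cat /= addnA.
Qed.

Lemma last_rev (T : Type) (p : T) s : last p (rev s) = head p s.
Proof. by case: s => [//|x s]; rewrite rev_cons last_rcons. Qed.

Lemma route_length_rev s : route_length (rev s) = route_length s.
Proof.
elim: s => [//|x s IHs]; rewrite rev_cons.
have [->//|s0] := eqVneq s [::].
have r0 : rev s != [::] by rewrite -size_eq0 size_rev size_eq0.
rewrite -cats1 (@route_length_cat x) // last_rev IHs.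
rewrite -[x :: s]cat1s (@route_length_cat x) //= addnC [l1dist x _]l1dist_sym.
by rewrite -addnA [(_ + route_length s)%N]addnC.
Qed.

Lemma route_length_map (f : point -> point) s :
  (forall p q, l1dist (f p) (f q) <= l1dist p q)%N ->
  (route_length (map f s) <= route_length s)%N.
Proof.
move=> f_contract; case: s => [//|x s]; rewrite map_cons !route_length_cons.
elim: s x => [//|y s IHs] x /=; exact: leq_add.
Qed.

Lemma alternate_neq0 b t ts : t != [::] -> alternate b (t :: ts) != [::].
Proof.
move=> t0 /=; rewrite -size_eq0 size_cat; case: ifP => _;
  rewrite ?size_rev addn_eq0 size_eq0 (negPf t0) //.
Qed.

(* Two consecutive members are joined either at their first or at their last
   points; [phi] is a potential whose increments dominate both distances. *)
Lemma route_length_alternate (p : point) (phi : seq point -> int) b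
    (t : seq point) (ts : seq (seq point)) :
  all (fun u => u != [::]) (t :: ts) ->
  path (fun u v => ((l1dist (last p u) (last p v))%:Z <= phi v - phi u)
                && ((l1dist (head p u) (head p v))%:Z <= phi v - phi u)) t ts ->
  (route_length (alternate b (t :: ts)))%:Z
  <= (sumn (map route_length (t :: ts)))%:Z + (phi (last t ts) - phi t).
Proof.
elim: ts b t => [|u ts IHts] b t.
  by rewrite /= cats0 => _ _; case: ifP; rewrite ?route_length_rev; lia.
move=> /andP[t0 us0]; rewrite [path _ _ _]/= => /andP[/andP[jl jh] pus].
have u0 : u != [::] by case/andP: us0.
have := IHts (~~ b) u us0 pus.
set rest := alternate (~~ b) (u :: ts) => le_rest.
rewrite -[alternate b _]/((if b then rev t else t) ++ rest).
rewrite (@route_length_cat p); last exact: alternate_neq0; last first.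
  by case: (b); rewrite // -size_eq0 size_rev size_eq0.
suff jump : (l1dist (last p (if b then rev t else t)) (head p rest))%:Z
            <= phi u - phi t.
  have -> : route_length (if b then rev t else t) = route_length t.
    by case: (b); rewrite ?route_length_rev.
  have arith (c j r c' s : nat) (x y z : int) :
      r%:Z <= (c' + s)%N%:Z + (z - y) -> j%:Z <= y - x ->
      (c + j + r)%N%:Z <= (c + (c' + s))%N%:Z + (z - x) by lia.
  exact: arith le_rest jump.
(* If [b] holds, [t] is walked backwards and [u] forwards, so the jump joins their heads; otherwise
   it joins their last points. *)
rewrite /rest /=; case: (b) => /=.
  by case: (u) (t) u0 t0 jh => [|x u'] [|y t'] //= _ _; rewrite last_rev.
by case/lastP: (u) u0 jl => [|u' x] // _; rewrite rev_rcons /= last_rcons.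
Qed.

Lemma perm_alternate b ts : perm_eq (alternate b ts) (flatten ts).
Proof.
elim: ts b => [|t ts IHts] b //=; apply: perm_cat => //.
by case: b; rewrite ?perm_rev.
Qed.

Lemma mem_alternate b ts : alternate b ts =i flatten ts.
Proof. exact/perm_mem/perm_alternate. Qed.

Lemma size_alternate b ts : size (alternate b ts) = sumn (map size ts).
Proof. by rewrite (perm_size (perm_alternate b ts)) size_flatten. Qed.

Lemma subseq_alternate (I : Type) (f g : I -> seq point) b s :
  (forall i, subseq (f i) (g i)) ->
  subseq (alternate b (map f s)) (alternate b (map g s)).
Proof.
move=> sub_fg; elim: s b => [//|i s IHs] b /=; apply: cat_subseq => //.
by case: b; rewrite ?subseq_rev.
Qed.

(** * Balls and the points gained by a step *)

Lemma odd_l1dist_triangle (p q r : point) :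
  odd (l1dist p r) = odd (l1dist p q) (+) odd (l1dist q r).
Proof. rewrite /l1dist; lia. Qed.

Lemma l1dist_interpolate (p q : point) (i : nat) : (i <= l1dist p q)%N ->
  exists2 c, l1dist p c = i & l1dist c q = (l1dist p q - i)%N.
Proof.
case: p q => [p1 p2] [q1 q2]; rewrite /l1dist /= => le_i.
(* Follow a shortest path that moves horizontally first: [a] of its first [i] steps are
   horizontal. *)
pose a : nat := minn i `|p1 - q1|.
exists (if p1 <= q1 then p1 + a%:Z else p1 - a%:Z,
        if p2 <= q2 then p2 + (i - a)%N%:Z else p2 - (i - a)%N%:Z);
  rewrite /a /=; do 2 (case: ifP => ?); lia.
Qed.

(* The l1 ball is the union of two interleaved square grids standing on a corner,
   each consisting of the points at a distance of fixed parity from the centre. *)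
Definition grid (s : nat) (c : point) : seq point :=
  [seq (c.1 + x%:Z + y%:Z + 1 - s%:Z, c.2 + x%:Z - y%:Z) : point
  | x <- iota 0 s, y <- iota 0 s].

Lemma size_grid s c : size (grid s c) = (s * s)%N.
Proof. by rewrite size_allpairs !size_iota. Qed.

Lemma grid_uniq s c : uniq (grid s c).
Proof.
apply: allpairs_uniq; rewrite ?iota_uniq // => -[x y] [x' y'] _ _ /= [e1 e2].
congr pair; lia.
Qed.

Lemma mem_grid s (c p : point) :
  (p \in grid s c) = (l1dist c p < s)%N && (odd (l1dist c p) (+) odd s).
Proof.
case: c p => [c1 c2] [p1 p2].
apply/allpairsP/idP => [[[x y] /= []]|].
  by rewrite !mem_iota => hx hy [-> ->]; rewrite /l1dist /=; lia.
rewrite /l1dist /= => h.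
(* In the rotated coordinates (p1 - c1) + (p2 - c2) = 2x + 1 - s and (p1 - c1) - (p2 - c2) = 2y + 1
   - s the grid is a square. *)
pose x : nat := (absz (p1 - c1 + (p2 - c2) + (s%:Z - 1))%R %/ 2)%N.
pose y : nat := (absz (p1 - c1 - (p2 - c2) + (s%:Z - 1))%R %/ 2)%N.
exists (x, y); rewrite !mem_iota /=; split; [rewrite /x; lia|rewrite /y; lia|].
congr pair; rewrite /x /y; lia.
Qed.

Definition ball (k : nat) (c : point) : seq point := grid k.+1 c ++ grid k c.

Definition ball_size (k : nat) : nat := (k.+1 * k.+1 + k * k)%N.

Lemma size_ball k c : size (ball k c) = ball_size k.
Proof. by rewrite size_cat !size_grid. Qed.

Lemma mem_ball k (c p : point) : (p \in ball k c) = (l1dist c p <= k)%N.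
Proof. rewrite mem_cat !mem_grid; lia. Qed.

Lemma ball_uniq k c : uniq (ball k c).
Proof.
rewrite cat_uniq !grid_uniq andbT; apply/hasPn => p; rewrite /= !mem_grid; lia.
Qed.

Definition gain (k d : nat) : nat := (d * k.*2.+1 - (d ^ 2)./2)%N.

(** Two balls with centres 2i apart share the ball of radius k - i about a midpoint, whence the term
    [ball_size (k - i)]. *)
Lemma gain_even k i : (i <= k)%N ->
  (gain k i.*2 + ball_size (k - i) = ball_size k)%N.
Proof.
move=> /subnK <-; set j := (k - i)%N; rewrite addnK /gain /ball_size.
have -> : (i.*2 ^ 2 = (2 * i ^ 2).*2)%N by nia.
rewrite doubleK; nia.
Qed.

(** For centres 2i + 1 apart the shared part consists of two square grids of side k - i about the
    two middle points. *)
Lemma gain_odd k i : (i <= k)%N ->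
  (gain k i.*2.+1 + 2 * (k - i) ^ 2 = ball_size k)%N.
Proof.
move=> /subnK <-; set j := (k - i)%N; rewrite addnK /gain /ball_size.
have -> : (i.*2.+1 ^ 2 = (2 * i ^ 2 + 2 * i).*2.+1)%N by nia.
rewrite -[(_.*2.+1)./2]/(uphalf _.*2) uphalf_double; nia.
Qed.

Lemma gain_max k : gain k k.*2.+1 = ball_size k.
Proof. by have := @gain_odd k k (leqnn k); rewrite subnn addn0. Qed.

(** Reduces an upper bound on the new points to exhibiting enough common points of the two balls. *)
Lemma leq_size_new k (p q : point) (s : seq point) :
  uniq s -> all (fun r => (l1dist p r <= k)%N && (l1dist q r <= k)%N) s ->
  (size [seq r <- ball k q | r \notin ball k p] + size s <= ball_size k)%N.
Proof.
move=> s_uniq /allP s_sub.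
rewrite -(size_ball k q) -(count_predC (mem (ball k p)) (ball k q)) addnC.
rewrite size_filter leq_add2r -size_filter.
apply: uniq_leq_size => // r /s_sub /andP[pr qr].
by rewrite mem_filter /= !mem_ball pr qr.
Qed.

(* The overlap of two balls contains the ball about the midpoint of their centres,
   or a pair of grids about the two midpoints when the distance is odd. *)
Lemma size_new k (p q : point) :
  (size [seq r <- ball k q | r \notin ball k p]
   <= gain k (minn (l1dist p q) k.*2.+1))%N.
Proof.
have [lt_k|le_k] := ltnP k.*2.+1 (l1dist p q).
  rewrite gain_max.
  have := @leq_size_new k p q [::] isT isT; by rewrite addn0.
set i := (l1dist p q)./2.
have le_i : (i <= l1dist p q)%N by lia.
have [c pc cq] := l1dist_interpolate le_i.
have [odd_d|even_d] := boolP (odd (l1dist p q)).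
  (* [c] is at distance i from [p], and [c'] is its neighbour on the way to [q]. The grids about
     them are disjoint by parity. *)
  have le_1 : (1 <= l1dist c q)%N by lia.
  have [c' cc' c'q] := l1dist_interpolate le_1.
  have pc' := l1dist_triangle c p c'.
  have d_eq : l1dist p q = i.*2.+1 by lia.
  have le_ik : (i <= k)%N by lia.
  rewrite d_eq -(leq_add2r (2 * (k - i) ^ 2)) (gain_odd le_ik).
  have -> : (2 * (k - i) ^ 2)%N = size (grid (k - i) c ++ grid (k - i) c').
    by rewrite size_cat !size_grid; lia.
  apply: leq_size_new.
    rewrite cat_uniq !grid_uniq andbT; apply/hasPn => r; rewrite /= !mem_grid.
    by have := odd_l1dist_triangle c' c r; rewrite [l1dist c' c]l1dist_sym cc'; lia.
  apply/allP => r; rewrite mem_cat !mem_grid.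
  have := l1dist_triangle c p r; have := l1dist_triangle c q r.
  have := l1dist_triangle c' p r; have := l1dist_triangle c' q r.
  rewrite ![l1dist q _]l1dist_sym.
  rewrite [l1dist r _]l1dist_sym; lia.
have d_eq : l1dist p q = i.*2 by lia.
have le_ik : (i <= k)%N by lia.
rewrite d_eq -(leq_add2r (ball_size (k - i))) (gain_even le_ik) -(size_ball _ c).
apply: leq_size_new; first exact: ball_uniq.
apply/allP => r; rewrite mem_ball.
have := l1dist_triangle c p r; have := l1dist_triangle c q r.
by rewrite [l1dist q c]l1dist_sym; lia.
Qed.

(** * Counting the points covered along a path *)

Definition new_points k (p : point) (s : seq point) : seq point :=
  flatten (pairmap (fun p q => [seq r <- ball k q | r \notin ball k p]) p s).

(** A point in the ball of a stop is either new there or already in the ball of the preceding stop.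
    Points may be listed repeatedly, which is harmless for an upper bound. *)
Lemma covered_by_new k p s (r : point) :
  has (fun F => l1dist r F <= k)%N (p :: s) -> r \in ball k p ++ new_points k p s.
Proof.
elim: s p => [|q s IHs] p.
  by rewrite /= orbF cats0 mem_ball l1dist_sym.
have -> : new_points k p (q :: s)
          = [seq r <- ball k q | r \notin ball k p] ++ new_points k q s by [].
case/orP => [|/IHs]; first by rewrite l1dist_sym mem_cat mem_ball => ->.
rewrite mem_cat => /orP[rq|r_new]; rewrite catA mem_cat; last first.
  by rewrite r_new orbT.
by rewrite mem_cat mem_filter rq andbT orbN.
Qed.

Lemma rect_points_uniq w h : uniq (rect_points w h).
Proof.
by apply: allpairs_uniq; rewrite ?iota_uniq // => -[a b] [c d] _ _ [/= -> ->].
Qed.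

Lemma size_rect_points w h : size (rect_points w h) = (w.+1 * h.+1)%N.
Proof. by rewrite size_allpairs !size_iota. Qed.

Lemma mem_rect_points w h p : (p \in rect_points w h) = in_rect w h p.
Proof.
case: p => a b; apply/allpairsP/idP => [[[x y] []]|].
  by rewrite !mem_iota /= => hx hy [-> ->]; rewrite /in_rect /=; lia.
rewrite /in_rect => rect_ab; exists (absz a, absz b).
rewrite !mem_iota; move: rect_ab => /= rect_ab; split; [lia|lia|congr pair; lia].
Qed.

(** The witness lists the distances between consecutive stops. Everything the lower bound needs to
    know about a covering path is contained in these step lengths. *)
Lemma covering_gain n m k Q : covering_path n m k Q ->
  exists ds : seq nat,
    [/\ (n.+1 * m.+1 <= ball_size k + sumn [seq gain k (minn d k.*2.+1) | d <- ds])%N,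
        all (leq 1) ds, (sumn ds <= path_length Q)%N
      & (size ds < stop_count Q)%N].
Proof.
case=> st_uniq _ sub cov; rewrite /path_length /stop_count.
case st: (stops Q) st_uniq sub cov => [|p s] st_uniq sub cov.
  by have [] := cov (0, 0); rewrite // /in_rect; lia.
exists (pairmap l1dist p s); split.
- rewrite -size_rect_points.
  apply: (@leq_trans (size (ball k p ++ new_points k p s))).
    apply: uniq_leq_size; first exact: rect_points_uniq.
    move=> r; rewrite mem_rect_points => /cov[F Fin rF].
    by apply: covered_by_new; apply/hasP; exists F.
  rewrite size_cat size_ball leq_add2l /new_points.
  elim: (s) (p) => [//|q s' IHs] p' /=; rewrite size_cat.
  by apply: leq_add; rewrite ?size_new.
(* Distinct integer points are at distance at least 1. *)
- elim: (s) (p) st_uniq => [//|q s' IHs] p' /= /and3P[].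
  rewrite inE negb_or => /andP[neq _] qs' us'; rewrite IHs /= ?qs' // andbT.
  apply: contraNT neq; case: p' q {qs' IHs} => [a b] [c d].
  by rewrite /l1dist /= xpair_eqE; lia.
- by rewrite -route_length_cons; apply: route_length_subseq.
- by rewrite size_pairmap.
Qed.

(** * Vertical traversals *)

Definition column (r w : nat) (i : nat) (s : seq nat) : seq point :=
  [seq ((traversal_x r w i)%:Z, y%:Z) : point | y <- s].

Lemma vertical_routeE k d w h :
  route (vertical_path k d w h) =
  alternate false [seq column (spacing k d) w i (iota 0 h.+1)
                  | i <- iota 0 (traversal_count (spacing k d) w)].
Proof. by congr alternate; apply: eq_map => i; rewrite filter_predT. Qed.

Lemma vertical_stopsE k d w h :
  stops (vertical_path k d w h) =
  alternate false [seq column (spacing k d) w i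
                         [seq y <- iota 0 h.+1 | stop_height d h i y]
                  | i <- iota 0 (traversal_count (spacing k d) w)].
Proof. by []. Qed.

Lemma route_length_column r w i h : route_length (column r w i (iota 0 h.+1)) = h.
Proof.
rewrite /column [iota _ _]/= map_cons route_length_cons.
elim: h 0%N => [//|h IHh] a; rewrite [iota _ _]/= map_cons [pairmap _ _ _]/=.
rewrite [sumn _]/= IHh /l1dist /=; lia.
Qed.

Lemma path_map_iota (T : Type) (e : rel T) (f : nat -> T) (c l : nat) :
  (forall i, e (f i) (f i.+1)) -> path e (f c) (map f (iota c.+1 l)).
Proof. by move=> e_f; elim: l c => [//|l IHl] c /=; rewrite e_f IHl. Qed.

Lemma traversal_x_le r w i : (traversal_x r w i <= w)%N.
Proof. exact: geq_minr. Qed.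

Lemma traversal_x_mono r w i : (traversal_x r w i <= traversal_x r w i.+1)%N.
Proof. rewrite /traversal_x mulSn; lia. Qed.

Lemma traversal_count_bound r w : (traversal_count r w * r <= w + 2 * r)%N.
Proof.
have := leq_trunc_div w r; rewrite /traversal_count.
by case: (_ %| _)%N => /=; nia.
Qed.

Lemma sumn_map_le (T : eqType) (f : T -> nat) (B : nat) (s : seq T) :
  {in s, forall x, (f x <= B)%N} -> (sumn (map f s) <= size s * B)%N.
Proof.
elim: s => [//|x s IHs] le_B /=; rewrite mulSn; apply: leq_add.
  by apply: le_B; rewrite mem_head.
by apply: IHs => y ys; apply: le_B; rewrite inE ys orbT.
Qed.

Lemma vertical_route_length k d w h :
  (route_length (route (vertical_path k d w h))
   <= traversal_count (spacing k d) w * h + w)%N.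
Proof.
rewrite vertical_routeE; set r := spacing k d.
set f := fun i => column r w i (iota 0 h.+1).
case E: (traversal_count r w) => [//|c]; rewrite -E.
(* All traversals share their bottom and top heights, so every join is as long as the difference of
   abscissae. With the abscissa as potential the joins total at most [w]. *)
pose p : point := (0, 0); pose phi (t : seq point) := (head p t).1.
have phiE i : phi (f i) = (traversal_x r w i)%:Z by [].
have headE i : head p (f i) = ((traversal_x r w i)%:Z, 0) by [].
have lastE i : last p (f i) = ((traversal_x r w i)%:Z, h%:Z).
  rewrite /f /column [iota _ _]/= map_cons -{2}[h]add0n -[_ :: _]/(_ :: _).
  rewrite [last _ _]/= (last_map (fun y => ((traversal_x r w i)%:Z, y%:Z) : point)).
  congr (_, _%:Z); by elim: (h) 0%N => [|h' IHh] a; rewrite ?addn0 //= IHh addSnnS.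
have nonempty : all (fun u => u != [::]) (map f (iota 0 c.+1)).
  by rewrite all_map; apply/allP.
have := @route_length_alternate p phi false (f 0%N) (map f (iota 1 c)) nonempty.
rewrite last_map !phiE -map_cons -[0%N :: _]/(iota 0 c.+1) -E => bound.
have {}bound := bound (path_map_iota _ _ _).
have le_sum : (sumn (map route_length (map f (iota 0 (traversal_count r w))))
               <= traversal_count r w * h)%N.
  rewrite -map_comp -{2}[traversal_count r w](size_iota 0).
  by apply: sumn_map_le => i _ /=; rewrite route_length_column.
have le_w := traversal_x_le r w (last 0%N (iota 1 c)).
rewrite -lez_nat; apply: (le_trans (bound _)) => [i|]; last by lia.
rewrite !lastE !headE !phiE /l1dist /= ; have := traversal_x_mono r w i; lia.
Qed.

(** Division by [d] is injective on a residue class, which leaves at most [h %/ d + 1] heights; the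
    stop at the top adds one. *)
Lemma size_stop_height d h i : (0 < d)%N ->
  (size [seq y <- iota 0 h.+1 | stop_height d h i y] <= h %/ d + 2)%N.
Proof.
move=> d_gt0; rewrite size_filter.
set c := (if odd i then d./2 else 0)%N.
pose a1 := fun y : nat => (y == c %[mod d])%N.
have le1 : (count a1 (iota 0 h.+1) <= (h %/ d).+1)%N.
  rewrite -size_filter -(size_map (divn^~ d)) -(size_iota 0 (h %/ d).+1).
  apply: uniq_leq_size.
    rewrite map_inj_in_uniq ?filter_uniq ?iota_uniq // => x y.
    rewrite !mem_filter => /andP[/eqP ex _] /andP[/eqP ey _] e_div.
    by rewrite (divn_eq x d) (divn_eq y d) e_div ex ey.
  move=> q /mapP[y]; rewrite mem_filter !mem_iota => /andP[_ /andP[_ lt_y]] ->.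
  by rewrite add0n ltnS leq_div2r.
have := count_predUI a1 (pred1 h) (iota 0 h.+1).
rewrite (count_uniq_mem h (iota_uniq 0 h.+1)).
rewrite -(@eq_count _ (stop_height d h i) (predU a1 (pred1 h))) //.
by have := leq_b1 (h \in iota 0 h.+1); lia.
Qed.

Lemma vertical_stop_count k d w h : (0 < d)%N ->
  (size (stops (vertical_path k d w h))
   <= traversal_count (spacing k d) w * (h %/ d + 2))%N.
Proof.
move=> d_gt0; rewrite vertical_stopsE size_alternate -map_comp.
rewrite -{2}[traversal_count _ w](size_iota 0).
by apply: sumn_map_le => i _ /=; rewrite size_map size_stop_height.
Qed.

Lemma vertical_route_in_rect k d w h :
  all (in_rect w h) (route (vertical_path k d w h)).
Proof.
rewrite vertical_routeE; apply/allP => p; rewrite mem_alternate => /flatten_mapP[i _].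
case/mapP => y; rewrite mem_iota => lt_y ->.
by have := traversal_x_le (spacing k d) w i; rewrite /in_rect /=; lia.
Qed.

Lemma vertical_stops_subseq k d w h :
  subseq (stops (vertical_path k d w h)) (route (vertical_path k d w h)).
Proof.
rewrite vertical_stopsE vertical_routeE; apply: subseq_alternate => i.
exact/map_subseq/filter_subseq.
Qed.

(* Distances from [b] to the two interleaved progressions of step [d] add up to
   [d / 2], which is what makes two neighbouring traversals at the prescribed
   spacing cover the strip between them. *)
Lemma stop_heights_interleave d b : (d == 1%N) || ~~ odd d -> (0 < d)%N ->
  exists y0 y1 : nat,
    [/\ (y0 = 0 %[mod d])%N, (y1 = d./2 %[mod d])%N
      & ((maxn b y0 - minn b y0) + (maxn b y1 - minn b y1) = d./2)%N].
Proof.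
case/orP => [/eqP-> _|d_even d_gt0].
  by exists b, b; rewrite !modn1 maxnn minnn subnn.
have := divn_eq b d; have := ltn_pmod b d_gt0.
set j := (b %/ d)%N; set t := (b %% d)%N => lt_t b_eq.
have [le_t|gt_t] := leqP t d./2.
  exists (j * d)%N, (j * d + d./2)%N; rewrite modnMl mod0n modnMDl; split=> //; lia.
exists (j.+1 * d)%N, (j * d + d./2)%N.
rewrite modnMl mod0n modnMDl mulSn; split=> //; lia.
Qed.

(** A height beyond the top is replaced by [h], where every traversal stops. *)
Lemma vertical_stop k d w h i y :
  (i < traversal_count (spacing k d) w)%N ->
  (y == (if odd i then d./2 else 0) %[mod d])%N ->
  ((traversal_x (spacing k d) w i)%:Z, (minn y h)%:Z)
    \in stops (vertical_path k d w h).
Proof.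
move=> lt_i y_mod; rewrite vertical_stopsE mem_alternate.
apply/flatten_mapP; exists i; first by rewrite mem_iota.
apply/mapP; exists (minn y h) => //.
rewrite mem_filter mem_iota add0n ltnS geq_minr leq0n andbT.
by rewrite /stop_height; case: leqP => _; rewrite ?y_mod ?eqxx ?orbT.
Qed.

(** Take one stop on each of the two neighbouring traversals. The horizontal distances add up to r =
    2k + 1 - d/2 and the vertical ones to d/2, so the two distances total 2k + 1 and one of them is
    at most k. *)
Lemma vertical_covers k d w h : (d == 1%N) || ~~ odd d -> (0 < d <= k.*2)%N ->
  forall p, in_rect w h p ->
    exists2 F, F \in stops (vertical_path k d w h) & (l1dist p F <= k)%N.
Proof.
move=> d_par /andP[d_gt0 d_le] [a b]; rewrite /in_rect /= => /andP[].
case: a => [a|//] a_le; case: b => [b|//] b_le.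
have [y0 [y1 [y0_mod y1_mod sum_dist]]] := stop_heights_interleave b d_par d_gt0.
have r_gt0 : (0 < spacing k d)%N by rewrite /spacing; lia.
have a_eq := divn_eq a (spacing k d); have lt_s := ltn_pmod a r_gt0.
have le_q : (a %/ spacing k d <= w %/ spacing k d)%N by rewrite leq_div2r; lia.
(* Clamping a stop to the rectangle brings it no farther from a point of the rectangle. *)
have cover (i y : nat) : (i < traversal_count (spacing k d) w)%N ->
    (y == (if odd i then d./2 else 0) %[mod d])%N ->
    (maxn a (i * spacing k d) - minn a (i * spacing k d)
     + (maxn b y - minn b y) <= k)%N ->
    exists2 F, F \in stops (vertical_path k d w h) & (l1dist (a%:Z, b%:Z) F <= k)%N.
  move=> lt_i y_mod near; exists ((traversal_x (spacing k d) w i)%:Z, (minn y h)%:Z).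
    exact: vertical_stop.
  move: near a_le b_le; rewrite /traversal_x /l1dist /=.
  by move: (i * _)%N => x; clear; lia.
move: a_eq lt_s le_q; move: (a %/ _)%N (a %% _)%N => i s a_eq lt_s le_q.
pose yl := if odd i then y1 else y0; pose yr := if odd i then y0 else y1.
have yl_mod : (yl == (if odd i then d./2 else 0) %[mod d])%N.
  by rewrite /yl; case: (odd i); apply/eqP.
have yr_mod : (yr == (if odd i.+1 then d./2 else 0) %[mod d])%N.
  by rewrite /yr /=; case: (odd i); apply/eqP.
have lr_dist : ((maxn b yl - minn b yl) + (maxn b yr - minn b yr) = d./2)%N.
  by rewrite /yl /yr; case: (odd i); rewrite // addnC.
have [left|right] := leqP (s + (maxn b yl - minn b yl)) k.
  apply: (cover i yl) => //.
    by rewrite /traversal_count ltnS (leq_trans le_q) ?leq_addr.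
  by rewrite a_eq (maxn_idPl (leq_addr _ _)) (minn_idPr (leq_addr _ _)) addKn.
(* On traversal i itself the vertical distance is at most d/2 <= k. Positivity of [s] ensures that
   traversal i + 1 exists even when the spacing divides [w]. *)
have s_gt0 : (0 < s)%N.
  move: right lr_dist d_le; move: (maxn b yl - _)%N (maxn b yr - _)%N => u v.
  by clear; lia.
apply: (cover i.+1 yr) => //; last first.
  move: right lr_dist d_le lt_s; rewrite a_eq mulSn /spacing.
  move: (maxn b yl - _)%N (maxn b yr - _)%N (i * _)%N => u v x.
  by clear; lia.
rewrite /traversal_count; case: (boolP (spacing k d %| w)%N) => [r_dvd|_] /=.
  rewrite addn0 ltnS ltn_neqAle le_q andbT.
  apply: contraL a_le => /eqP i_eq.
  by rewrite lez_nat -ltnNge -(divnK r_dvd) -i_eq a_eq -addn1 leq_add2l.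
by rewrite addn1 !ltnS.
Qed.

(** Away from the boundary each stop accounts for a cell of height [d] and width [spacing k d], so
    vertical paths attain the gain. *)
Lemma gain_vertical k d : (d == 1%N) || ~~ odd d -> (d <= k.*2)%N ->
  gain k d = (d * spacing k d)%N.
Proof.
case/orP => [/eqP-> _|d_even d_le]; first by rewrite /gain /spacing /= !mul1n.
have [i ->] : exists i, d = i.*2 by exists d./2; lia.
rewrite /gain /spacing doubleK.
have -> : (i.*2 ^ 2 = (2 * i ^ 2).*2)%N by nia.
rewrite doubleK mulnBr; congr (_ - _)%N; nia.
Qed.

(** * The zigzag lattice *)

Lemma zz_modulusE k : zz_modulus k = (ball_size k)%:Z.
Proof. by congr Posz; rewrite /ball_size; nia. Qed.

Lemma zz_modulus_int k : zz_modulus k = 2 * k%:Z * k%:Z + 2 * k%:Z + 1.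
Proof. by rewrite zz_modulusE /ball_size; lia. Qed.

Lemma zz_modulus_gt0 k : 0 < zz_modulus k.
Proof. by rewrite zz_modulusE /ball_size; lia. Qed.

Lemma zz_latticeE k p : zz_lattice k p -> zz_form k p = zz_index k p * zz_modulus k.
Proof. by move=> p_zz; rewrite /zz_index divzK. Qed.

Lemma zz_latticeI k p (t : int) : zz_form k p = t * zz_modulus k ->
  zz_lattice k p /\ zz_index k p = t.
Proof.
move=> eq_t; rewrite /zz_lattice /zz_index eq_t dvdz_mull //; split=> //.
by rewrite mulzK // gt_eqF ?zz_modulus_gt0.
Qed.

(* The values of [k x + (k + 1) y] on the ball of radius [k] are exactly the
   integers of absolute value at most [k ^ 2 + k], a full set of residues. *)
Lemma zz_lattice_near k p : exists2 q, zz_lattice k q & (l1dist p q <= k)%N.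
Proof.
set K := k%:Z; set M := zz_modulus k.
have K_ge0 : 0 <= K by [].
have M_eq : M = 2 * K * K + 2 * K + 1 by exact: zz_modulus_int.
set t := ((zz_form k p + K * K + K) %/ M)%Z.
set v := zz_form k p - t * M.
have v_ge : - (K * K + K) <= v.
  have := modz_ge0 (zz_form k p + K * K + K) (lt0r_neq0 (zz_modulus_gt0 k)).
  by rewrite /modz -/M -/t /v; lia.
have v_le : v <= K * K + K.
  have := ltz_pmod (zz_form k p + K * K + K) (zz_modulus_gt0 k).
  by rewrite /modz -/M -/t /v M_eq; lia.
have d_gt0 : 0 < 2 * K + 1 by lia.
(* Since v = K (u - e) + (K + 1) e, moving back by (u - e, e) removes [v]. Its l1 length is the
   maximum of |u| and |u - 2e|, and rounding 2v / (2K + 1) to the nearest integer [u] keeps both at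
   most K. *)
set u := ((2 * v + K) %/ (2 * K + 1))%Z.
have w_ge := modz_ge0 (2 * v + K) (lt0r_neq0 d_gt0).
have w_lt := ltz_pmod (2 * v + K) d_gt0.
rewrite /modz -/u in w_ge w_lt.
have u_le : u <= K by nia.
have u_ge : - K <= u by nia.
pose e := v - K * u.
exists (p.1 - (u - e), p.2 - e).
  have [] // := @zz_latticeI k (p.1 - (u - e), p.2 - e) t.
  rewrite -/M; have : zz_form k p = v + t * M by rewrite /v; lia.
  by rewrite /zz_form /e -/K -[k.+1%:Z]/(Posz k.+1) /=; lia.
rewrite /l1dist /=.
have abs1 : u - 2 * e <= K by rewrite /e; lia.
have abs2 : - K <= u - 2 * e by rewrite /e; lia.
move: (e) abs1 abs2 u_le u_ge => e' ; rewrite /K; clear; lia.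
Qed.

(** In the rotated coordinates a + b and a - b the lattice is spanned by (1, 2K + 1) and (2K + 1,
    -1). If t < 0, the first bound forces s >= 1, which violates the second; t > 0 is symmetric. *)
Lemma zz_coordinates_small (K s t : int) : 0 <= K ->
  `|s + (2 * K + 1) * t| <= 2 * K -> `|(2 * K + 1) * s - t| <= 2 * K ->
  s = 0 /\ t = 0.
Proof.
move=> K_ge0; set D := 2 * K + 1 => le1 le2; have D_ge0 : 0 <= D by lia.
have pos (x : int) : 1 <= x -> D <= D * x by move=> ?; rewrite ler_peMr.
have neg (x : int) : x <= -1 -> D * x <= - D.
  by move=> x_le; rewrite -[x]opprK mulrN lerN2 pos; lia.
have [t_lt|t_gt|t0] := ltrgtP t 0.
- by have := neg t; have := pos s; lia.
- by have := pos t; have := neg s; lia.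
- by split=> //; move: le1 le2; rewrite t0 mulr0; have := pos s; have := neg s; lia.
Qed.

Lemma zz_separated k p q : zz_lattice k p -> zz_lattice k q ->
  (l1dist p q <= k.*2)%N -> p = q.
Proof.
case: p q => [p1 p2] [q1 q2] /zz_latticeE fp /zz_latticeE fq near.
set K := k%:Z; set M := zz_modulus k in fp fq.
have K_ge0 : 0 <= K by [].
have M_eq : M = 2 * K * K + 2 * K + 1 by exact: zz_modulus_int.
pose a := p1 - q1; pose b := p2 - q2.
move: fp fq; rewrite /zz_form /= -/K.
set ip := zz_index _ _; set iq := zz_index _ _ => fp fq.
(* The orthogonal form (K + 1) a - K b is a multiple of M too: K times it equals M ((K + 1) t - b),
   and M - 2K (K + 1) = 1 yields the quotient [s]. *)
pose t := ip - iq; pose s := ((K + 1) * a - K * b) - 2 * (K + 1) * ((K + 1) * t - b).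
have ft : K * a + (K + 1) * b = t * M.
  by rewrite /a /b /t mulrBl -fp -fq; lia.
have fs : (K + 1) * a - K * b = s * M.
  have : K * ((K + 1) * a - K * b) = (K + 1) * (t * M) - b * M by rewrite -ft M_eq; ring.
  by rewrite /s; nia.
have aE : a = (K + 1) * s + K * t.
  apply: (mulIf (lt0r_neq0 (zz_modulus_gt0 k))); rewrite -/M.
  have -> : ((K + 1) * s + K * t) * M = (K + 1) * (s * M) + K * (t * M) by ring.
  by rewrite -fs -ft M_eq; ring.
have bE : b = (K + 1) * t - K * s.
  apply: (mulIf (lt0r_neq0 (zz_modulus_gt0 k))); rewrite -/M.
  have -> : ((K + 1) * t - K * s) * M = (K + 1) * (t * M) - K * (s * M) by ring.
  by rewrite -fs -ft M_eq; ring.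
have ab_le : `|a + b| <= 2 * K by move: near; rewrite /l1dist /a /b /K /=; clear; lia.
have ab_le' : `|a - b| <= 2 * K by move: near; rewrite /l1dist /a /b /K /=; clear; lia.
have sumE : a + b = s + (2 * K + 1) * t by rewrite aE bE; ring.
have difE : a - b = (2 * K + 1) * s - t by rewrite aE bE; ring.
rewrite sumE in ab_le; rewrite difE in ab_le'.
have [s0 t0] := zz_coordinates_small K_ge0 ab_le ab_le'.
move: aE bE; rewrite t0 s0 !mulr0 addr0 ?subr0 /a /b.
by move=> /subr0_eq -> /subr0_eq ->.
Qed.

Definition in_margin (k w h : nat) (p : point) : bool :=
  (- k%:Z <= p.1 <= w%:Z + k%:Z) && (- k%:Z <= p.2 <= h%:Z + k%:Z).

(** The balls about the points are disjoint by [zz_separated] and lie within 2k of the rectangle in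
    each coordinate; the shift by 2k makes the coordinates nonnegative. *)
Lemma zz_packing k w h (s : seq point) : uniq s -> all (zz_lattice k) s ->
  all (in_margin k w h) s ->
  (ball_size k * size s <= (w + 4 * k).+1 * (h + 4 * k).+1)%N.
Proof.
move=> s_uniq s_zz s_in.
pose shift (p : point) : point := (p.1 + 2 * k%:Z, p.2 + 2 * k%:Z).
have shift_inj : injective shift by move=> [a b] [c d] [e1 e2]; congr pair; lia.
have -> : (ball_size k * size s)%N = size (map shift (flatten (map (ball k) s))).
  rewrite size_map size_flatten /shape -map_comp.
  by elim: (s) => [|p s' IHs] /=; rewrite ?muln0 // mulnS IHs -(size_ball k p).
rewrite -size_rect_points; apply: uniq_leq_size.
  rewrite (map_inj_uniq shift_inj).
  elim: s s_uniq s_zz {s_in} => [//|p s IHs] /andP[ps us] /andP[p_zz s_zz].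
  rewrite map_cons -[flatten _]/(ball k p ++ flatten (map (ball k) s)) cat_uniq.
  rewrite ball_uniq IHs // andbT; apply/hasPn => r /flatten_mapP[q qs].
  rewrite mem_ball => qr; apply/negP => rp.
  have pr : (l1dist p r <= k)%N by rewrite -mem_ball.
  have pq : p = q.
    apply: (zz_separated p_zz (allP s_zz q qs)).
    by have := l1dist_triangle r p q; rewrite [l1dist r q]l1dist_sym; lia.
  by rewrite pq qs in ps.
move=> _ /mapP[r /flatten_mapP[q qs] qr ->].
rewrite mem_rect_points; move: qr (allP s_in q qs); rewrite mem_ball.
by case: q r {qs} => [a b] [c d]; rewrite /in_margin /in_rect /shift /l1dist /=; lia.
Qed.

(** * Zigzag traversals *)

(** Keeping the whole box, rather than only the points near the rectangle, ensures that the lattice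
    points between two members on a line are members as well. *)
Definition zz_margin_points (k w h : nat) : seq point :=
  [seq p <- [seq (x%:Z - k%:Z, y%:Z - k%:Z) : point |
               x <- iota 0 (w + k.*2).+1, y <- iota 0 (h + k.*2).+1]
     | zz_lattice k p].

Lemma zz_points_filter k w h :
  zz_points k w h =
  [seq p <- zz_margin_points k w h
     | has (fun q => l1dist q p <= k)%N (rect_points w h)].
Proof. by rewrite -filter_predI; apply: eq_filter => p /=; rewrite andbC. Qed.

Lemma mem_zz_margin_points k w h p :
  (p \in zz_margin_points k w h) = zz_lattice k p && in_margin k w h p.
Proof.
rewrite mem_filter; congr andb; case: p => a b; apply/allpairsP/idP.
  move=> [[x y] []]; rewrite !mem_iota => hx hy [-> ->].
  by move: hx hy; rewrite /in_margin /=; lia.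
rewrite /in_margin => ab_in.
exists (absz (a + k%:Z), absz (b + k%:Z)); rewrite !mem_iota.
by move: ab_in => /= ab_in; split; [lia|lia|congr pair; lia].
Qed.

Lemma zz_margin_points_uniq k w h : uniq (zz_margin_points k w h).
Proof.
apply/filter_uniq/allpairs_uniq; rewrite ?iota_uniq // => -[a b] [c d] _ _ /= [e1 e2].
by congr pair; lia.
Qed.

Lemma zz_pointsP k w h p :
  reflect (zz_lattice k p /\ exists2 q, in_rect w h q & (l1dist q p <= k)%N)
          (p \in zz_points k w h).
Proof.
rewrite zz_points_filter mem_filter mem_zz_margin_points.
apply: (iffP and3P) => [[/hasP[q]]|[p_zz [q q_in qp]]].
  by rewrite mem_rect_points => q_in qp p_zz _; split=> //; exists q.
split=> //; first by apply/hasP; exists q; rewrite ?mem_rect_points.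
by move: q_in qp; rewrite /in_rect /in_margin /l1dist; lia.
Qed.

Lemma zz_points_in_margin k w h p : p \in zz_points k w h -> in_margin k w h p.
Proof. by rewrite zz_points_filter mem_filter mem_zz_margin_points => /and3P[]. Qed.

Lemma mem_zz_traversal k w h i p :
  (p \in zz_traversal k w h i) = (zz_index k p == i) && (p \in zz_points k w h).
Proof. by rewrite mem_sort mem_filter. Qed.

Definition below (p q : point) : bool := p.2 <= q.2.

Lemma below_total : total below.
Proof. by move=> p q; exact: le_total. Qed.

Lemma below_trans : transitive below.
Proof. by move=> p q r; exact: le_trans. Qed.

Lemma zz_traversal_sorted k w h i : sorted below (zz_traversal k w h i).
Proof. exact/sort_sorted/below_total. Qed.

Lemma sorted_below_ends p0 (s : seq point) p : sorted below s -> p \in s ->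
  (head p0 s).2 <= p.2 <= (last p0 s).2.
Proof.
case: s => [//|x s] /= s_sorted p_in; apply/andP; split.
  have := order_path_min below_trans s_sorted; move/allP => min_x.
  by move: p_in; rewrite inE => /orP[/eqP->|/min_x].
elim: s x p s_sorted p_in => [|y s IHs] x p /=; first by rewrite inE => _ /eqP->.
move=> /andP[xy ys]; rewrite inE => /orP[/eqP->|]; last exact: IHs ys.
exact: le_trans (xy : x.2 <= y.2) (IHs y y ys (mem_head _ _)).
Qed.

Lemma zz_form_slope (k : nat) (x y : point) : (0 < k)%N ->
  zz_form k x = zz_form k y ->
  x.2 <= y.2 -> y.1 <= x.1.
Proof.
move=> k_gt0; rewrite /zz_form -[k.+1%:Z]/(Posz k.+1) => e le2.
rewrite -(@ler_pM2l _ k%:Z) //.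
have : 0 <= k.+1%:Z * (y.2 - x.2) by apply: mulr_ge0 => //; rewrite subr_ge0.
by rewrite mulrBr; move: e; rewrite -[Posz k.+1]/(k.+1%:Z); lra.
Qed.

(** Lines of constant [zz_form] have negative slope, so going up also means going left and the grid
    distances telescope. *)
Lemma walk_on_line (k : nat) (x : point) (s : seq point) : (0 < k)%N ->
  path below x s -> all (fun p => zz_form k p == zz_form k x) s ->
  (walk x s)%:Z
  = ((last x s).2 - x.2) + (x.1 - (last x s).1).
Proof.
move=> k_gt0; elim: s x => [|y s IHs] x; first by rewrite /= !subrr.
move=> /= /andP[xy ys] /andP[/eqP fy fs].
rewrite PoszD IHs //; last by apply: sub_all fs => p /eqP->; rewrite fy.
have := zz_form_slope k_gt0 (esym fy) xy.
by move: xy; rewrite /l1dist /below; lia.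
Qed.

(** Neighbouring lattice points on a line differ by (-(k + 1), k), at distance 2k + 1. The length is
    charged to the lattice points between the ends, whether or not they occur in [s]. *)
Lemma route_length_on_line k w h (s : seq point) (i : int) : (0 < k)%N ->
  s != [::] -> sorted below s ->
  all (fun p => zz_lattice k p && (zz_index k p == i)) s ->
  all (in_margin k w h) s ->
  (route_length s
   <= k.*2.+1 * count (fun p => zz_index k p == i) (zz_margin_points k w h))%N.
Proof.
case: s => [//|x s] k_gt0 _ /= s_sorted /andP[/andP[x_zz /eqP x_i] s_zz] /andP[x_in s_in].
have form_s p : p \in s -> zz_form k p = zz_form k x.
  move=> /(allP s_zz)/andP[p_zz /eqP p_i].
  by rewrite !zz_latticeE // p_i x_i.
have walk_eq : (route_length (x :: s))%:Z = ((last x s).2 - x.2) + (x.1 - (last x s).1).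
  rewrite route_length_cons (walk_on_line k_gt0) //.
  by apply/allP => p /form_s->.
set f := last x s in walk_eq.
have f_in : in_margin k w h f.
  by rewrite /f; apply: (allP (_ : all _ (x :: s))); rewrite ?mem_last //= x_in.
have f_form : zz_form k f = zz_form k x.
  by have := mem_last x s; rewrite inE => /orP[/eqP|/form_s //]; rewrite -/f => ->.
have f_above : x.2 <= f.2.
  by have /andP[] := @sorted_below_ends x (x :: s) x s_sorted (mem_head x s).
have f_left := zz_form_slope k_gt0 (esym f_form) f_above.
(* [T] counts lattice steps from [x] to [f]: the run is (k + 1) T and the rise is k T, so their
   difference gives [T] without a division. *)
pose T := (x.1 - f.1) - (f.2 - x.2).
have TE : k%:Z * T = f.2 - x.2 by move: f_form; rewrite /zz_form /T; lia.
have TE' : (k%:Z + 1) * T = x.1 - f.1 by rewrite mulrDl TE mul1r /T; lia.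
have T_ge0 : 0 <= T by rewrite -(@pmulr_rge0 _ k%:Z) // TE subr_ge0.
pose step (j : nat) : point := (x.1 - (k%:Z + 1) * j%:Z, x.2 + k%:Z * j%:Z).
have step_zz j : zz_lattice k (step j) /\ zz_index k (step j) = i.
  apply: zz_latticeI; rewrite -x_i -zz_latticeE // /zz_form /step /=.
  by rewrite -addn1 PoszD; ring.
have len : route_length (x :: s) = (k.*2.+1 * absz T)%N by nia.
rewrite len leq_mul2l /=.
apply: (@leq_trans (size (map step (iota 0 (absz T).+1)))).
  by rewrite size_map size_iota.
rewrite -size_filter; apply: uniq_leq_size.
  rewrite map_inj_uniq ?iota_uniq // => j j' [/eqP + _].
  rewrite (inj_eq (addrI _)) eqr_opp => /eqP/mulfI e.
  by apply: succn_inj; have := e _; lia.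
move=> _ /mapP[j + ->]; rewrite mem_iota => j_le.
have [j_zz j_i] := step_zz j.
rewrite mem_filter j_i eqxx mem_zz_margin_points j_zz /=.
have le1 : (k%:Z + 1) * j%:Z <= (k%:Z + 1) * T by rewrite ler_wpM2l //; lia.
have le2 : k%:Z * j%:Z <= k%:Z * T by rewrite ler_wpM2l //; lia.
have ge1 : 0 <= (k%:Z + 1) * j%:Z by rewrite mulr_ge0.
have ge2 : 0 <= k%:Z * j%:Z by rewrite mulr_ge0.
move: x_in f_in; rewrite /in_margin /step /= TE' in le1 *; rewrite TE in le2.
by move: (_ * j%:Z) (_ * j%:Z) le1 le2 ge1 ge2 => u v; clear; lia.
Qed.

(** * Jumps between zigzag traversals *)

Definition upper_left (k h : nat) (p : point) : bool :=
  (p.1 <= k%:Z) || (h%:Z - k%:Z < p.2).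

Lemma upper_left_jump k w h (e f : point) (g : int) : (0 < k)%N -> 1 <= g ->
  in_margin k w h e -> in_margin k w h f -> upper_left k h e -> upper_left k h f ->
  zz_form k f - zz_form k e = g * zz_modulus k ->
  (l1dist e f)%:Z <= 14 * k%:Z * g.
Proof.
case: e f => [e1 e2] [f1 f2] k_gt0 g_ge1.
rewrite /in_margin /upper_left /zz_form /= zz_modulus_int => e_in f_in e_ul f_ul.
set K := k%:Z in e_in f_in e_ul f_ul *.
pose X := f1 - e1; pose Y := f2 - e2 => form_eq.
have K_ge1 : 1 <= K by lia.
have {form_eq} XY : K * X + (K + 1) * Y = g * (2 * K * K + 2 * K + 1).
  by rewrite -form_eq /X /Y -addn1 PoszD; ring.
(* Both points near the left side, both near the top, or one near each, in either order. *)
have cases : [|| (- (2 * K) <= X <= 2 * K), (- (2 * K) <= Y <= 2 * K),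
                 (- (2 * K) <= X) && (- (2 * K) <= Y) | (X <= 2 * K) && (Y <= 2 * K)
             ].
  by move: e_in f_in e_ul f_ul; rewrite /X /Y; clear; lia.
have -> : (l1dist (e1, e2) (f1, f2))%:Z = `|X| + `|Y| by rewrite /l1dist /= /X /Y; lia.
move: cases g_ge1 K_ge1 XY; move: K X Y {e_in f_in e_ul f_ul}; clear => K X Y.
have Kg : 1 <= g -> 1 <= K -> K <= K * g /\ g <= K * g by move=> *; split; nia.
move=> cases g1 K1 XY; have [Kg1 Kg2] := Kg g1 K1.
have KKg : K * K <= K * (K * g) by rewrite ler_wpM2l //; lia.
(* K X <= g M + 2K (K + 1), where M <= 5 K^2 and K + 1 <= 2K, gives the 9; together with the 5 for
   [Y] it makes up 14. When neither coordinate exceeds 2K, the positive form keeps both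
   nonnegative. *)
have boundX : -(2 * K) <= Y -> X <= 9 * (K * g).
  by move=> Y_ge; rewrite -(@ler_pM2l _ K); nia.
have boundY : -(2 * K) <= X -> Y <= 5 * (K * g).
  by move=> X_ge; rewrite -(@ler_pM2l _ (K + 1)); nia.
have boundX' : Y <= 2 * K -> 0 <= X.
  by move=> Y_ge; rewrite -(@pmulr_rge0 _ K); nia.
have boundY' : X <= 2 * K -> 0 <= Y.
  by move=> Y_ge; rewrite -(@pmulr_rge0 _ (K + 1)); nia.
rewrite -mulrA; move: (K * g) Kg1 Kg2 boundX boundY boundX' boundY' => Z.
by clear -cases K1; lia.
Qed.

Definition reflect_point (w h : nat) (p : point) : point := (w%:Z - p.1, h%:Z - p.2).

(** A half-turn of the rectangle exchanges the two corners and negates differences of [zz_form], so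
    [e] and [f] change roles. *)
Lemma lower_right_jump k w h (e f : point) (g : int) : (0 < k)%N -> 1 <= g ->
  in_margin k w h e -> in_margin k w h f ->
  upper_left k h (reflect_point w h e) -> upper_left k h (reflect_point w h f) ->
  zz_form k f - zz_form k e = g * zz_modulus k ->
  (l1dist e f)%:Z <= 14 * k%:Z * g.
Proof.
move=> k_gt0 g_ge1 e_in f_in e_lr f_lr form_eq.
have -> : l1dist e f = l1dist (reflect_point w h f) (reflect_point w h e).
  by rewrite /l1dist /=; lia.
apply: (@upper_left_jump k w h) => //.
- by move: f_in; rewrite /in_margin /=; lia.
- by move: e_in; rewrite /in_margin /=; lia.
- by rewrite -form_eq /zz_form /=; ring.
Qed.

Lemma sumn_count_classes (T : eqType) (f : T -> int) (s : seq T) (js : seq int) :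
  uniq js -> (sumn [seq count (fun x => f x == j) s | j <- js] <= size s)%N.
Proof.
move=> js_uniq; elim: s => [|x s IHs].
  by rewrite sumnE big_map big1.
rewrite sumnE big_map big_split /= -[(size s).+1]add1n.
apply: leq_add; last by rewrite sumnE big_map in IHs.
have := count_uniq_mem (f x) js_uniq.
rewrite -sumn_count sumnE big_map => e; under eq_bigr do rewrite eq_sym.
by rewrite e; case: (_ \in _).
Qed.

Section ZigzagPath.

Variables k w h : nat.
Hypothesis k_gt0 : (0 < k)%N.

Local Notation indices :=
  (sort <=%R (undup [seq zz_index k p | p <- zz_points k w h])).
Local Notation traversals := [seq zz_traversal k w h i | i <- indices].
Local Notation origin := ((0, 0) : point).

Lemma mem_indices i : (i \in indices) = (zz_traversal k w h i != [::]).
Proof.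
rewrite mem_sort mem_undup; apply/mapP/idP => [[p p_in ->]|].
  have : p \in zz_traversal k w h (zz_index k p) by rewrite mem_zz_traversal eqxx.
  by case: (zz_traversal _ _ _ _).
case E: (zz_traversal k w h i) => [//|p s] _.
have : p \in zz_traversal k w h i by rewrite E mem_head.
by rewrite mem_zz_traversal => /andP[/eqP <- p_in]; exists p.
Qed.

Lemma head_traversal i : i \in indices ->
  head origin (zz_traversal k w h i) \in zz_traversal k w h i.
Proof.
by rewrite mem_indices; case: (zz_traversal _ _ _ _) => [//|p s] _; rewrite mem_head.
Qed.

Lemma last_traversal i : i \in indices ->
  last origin (zz_traversal k w h i) \in zz_traversal k w h i.
Proof.
rewrite mem_indices; case: (zz_traversal _ _ _ _) => [//|p s] _.
exact: (mem_last p s).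
Qed.

Lemma zz_traversal_form i p : p \in zz_traversal k w h i ->
  zz_form k p = i * zz_modulus k.
Proof. by rewrite mem_zz_traversal => /andP[/eqP <- /zz_pointsP[/zz_latticeE]]. Qed.

Lemma zz_traversal_in_margin i p : p \in zz_traversal k w h i -> in_margin k w h p.
Proof. by rewrite mem_zz_traversal => /andP[_ /zz_points_in_margin]. Qed.

Lemma mem_traversal_of_form i p : zz_form k p = i * zz_modulus k ->
  in_rect w h p -> p \in zz_traversal k w h i.
Proof.
move=> /zz_latticeI[p_zz p_i] p_in; rewrite mem_zz_traversal p_i eqxx.
by apply/zz_pointsP; split=> //; exists p => //; rewrite l1dist_self.
Qed.

(* Otherwise the next lattice point of the line would still lie in the rectangle. *)
Lemma last_traversal_upper_left i : i \in indices ->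
  upper_left k h (last origin (zz_traversal k w h i)).
Proof.
move=> i_in; have e_in := last_traversal i_in; set e := last _ _ in e_in *.
apply: contraT => e_not.
pose e' : point := (e.1 - k.+1%:Z, e.2 + k%:Z).
have e'_in : e' \in zz_traversal k w h i.
  apply: mem_traversal_of_form.
    by rewrite -(zz_traversal_form e_in) /zz_form /=; ring.
  move: e_not (zz_traversal_in_margin e_in).
  by rewrite /upper_left /in_margin /in_rect /=; lia.
have /andP[_] := sorted_below_ends origin (zz_traversal_sorted k w h i) e'_in.
by rewrite -/e /=; lia.
Qed.

(** Otherwise the preceding lattice point of the line would lie in the rectangle. *)
Lemma head_traversal_lower_right i : i \in indices ->
  upper_left k h (reflect_point w h (head origin (zz_traversal k w h i))).
Proof.
move=> i_in; have e_in := head_traversal i_in; set e := head _ _ in e_in *.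
apply: contraT => e_not.
pose e' : point := (e.1 + k.+1%:Z, e.2 - k%:Z).
have e'_in : e' \in zz_traversal k w h i.
  apply: mem_traversal_of_form.
    by rewrite -(zz_traversal_form e_in) /zz_form /=; ring.
  move: e_not (zz_traversal_in_margin e_in).
  by rewrite /upper_left /in_margin /in_rect /=; lia.
have /andP[] := sorted_below_ends origin (zz_traversal_sorted k w h i) e'_in.
by rewrite -/e /=; lia.
Qed.

Lemma traversal_jumps i j : i \in indices -> j \in indices -> i < j ->
  ((l1dist (last origin (zz_traversal k w h i)) (last origin (zz_traversal k w h j)))%:Z
     <= 14 * k%:Z * (j - i)) &&
  ((l1dist (head origin (zz_traversal k w h i)) (head origin (zz_traversal k w h j)))%:Z
     <= 14 * k%:Z * (j - i)).
Proof.
move=> i_in j_in lt_ij; have g_ge1 : 1 <= j - i by lia.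
have li := last_traversal i_in; have lj := last_traversal j_in.
have hi := head_traversal i_in; have hj := head_traversal j_in.
apply/andP; split.
  apply: (@upper_left_jump k w h); rewrite ?last_traversal_upper_left //.
  - exact: zz_traversal_in_margin li.
  - exact: zz_traversal_in_margin lj.
  - by rewrite (zz_traversal_form li) (zz_traversal_form lj) mulrBl.
apply: (@lower_right_jump k w h); rewrite ?head_traversal_lower_right //.
- exact: zz_traversal_in_margin hi.
- exact: zz_traversal_in_margin hj.
- by rewrite (zz_traversal_form hi) (zz_traversal_form hj) mulrBl.
Qed.

(** Each traversal is charged to the margin points of its own index, and these classes are
    disjoint. *)
Lemma sumn_traversal_lengths :
  (sumn (map route_length traversals)
   <= k.*2.+1 * size (zz_margin_points k w h))%N.
Proof.
have js_uniq : uniq indices by rewrite sort_uniq undup_uniq.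
apply: leq_trans (_ : k.*2.+1 * sumn [seq count (fun p => zz_index k p == i)
    (zz_margin_points k w h) | i <- indices] <= _)%N; last first.
  by rewrite leq_mul2l sumn_count_classes ?orbT.
rewrite -map_comp !sumnE !big_map big_distrr /= big_seq [leqRHS]big_seq.
apply: leq_sum => i i_in; apply: route_length_on_line => //.
- by rewrite -mem_indices.
- exact: zz_traversal_sorted.
- apply/allP => p; rewrite mem_zz_traversal => /andP[-> p_in].
  by rewrite andbT; case/zz_pointsP: p_in.
- by apply/allP => p /zz_traversal_in_margin.
Qed.

(** The jumps telescope through [phi], and the range of [zz_form] on the margin box bounds the range
    of the indices times the modulus. Multiplying by [ball_size k], which is the modulus, avoids a
    division. *)
Lemma zigzag_length_bound :
  (ball_size k * route_length (alternate false traversals)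
   <= k.*2.+1 * (ball_size k * size (zz_margin_points k w h))
      + 14 * k * (k * (w + k.*2) + k.+1 * (h + k.*2)))%N.
Proof.
case E: indices => [|i js]; first by rewrite muln0.
have js_sorted : path <%R i js.
  by have := sort_lt_sorted (undup [seq zz_index k p | p <- zz_points k w h]);
     rewrite undup_uniq E.
have js_in : all (mem indices) (i :: js) by rewrite E; apply/allP.
pose phi (t : seq point) : int := 14 * k%:Z * zz_index k (head origin t).
have phiE j : j \in indices -> phi (zz_traversal k w h j) = 14 * k%:Z * j.
  by move=> /head_traversal; rewrite mem_zz_traversal /phi => /andP[/eqP->].
have i_in : i \in indices by apply: (allP js_in); rewrite mem_head.
have l_in : last i js \in indices by apply: (allP js_in); rewrite mem_last.
have := @route_length_alternate origin phi false (zz_traversal k w h i)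
          (map (zz_traversal k w h) js).
rewrite last_map -map_cons !phiE // => bound.
have le_sum := sumn_traversal_lengths; rewrite E in le_sum.
have {}bound :
   (route_length (alternate false [seq zz_traversal k w h i | i <- i :: js]))%:Z
   <= (k.*2.+1 * size (zz_margin_points k w h))%N%:Z + 14 * k%:Z * (last i js - i).
  apply: le_trans (bound _ _) _; last by rewrite mulrBr lerD2r.
    rewrite all_map; apply/allP => j /(allP js_in) j_in /=.
    by rewrite -mem_indices.
  rewrite path_map; apply: (sub_in_path _ js_in js_sorted) => a b a_in b_in /= lt_ab.
  by rewrite !phiE // -mulrBr traversal_jumps.
have idx_le : (last i js - i) * zz_modulus k
              <= k%:Z * (w + k.*2)%N%:Z + k.+1%:Z * (h + k.*2)%N%:Z.
  have ei := head_traversal i_in; have el := head_traversal l_in.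
  rewrite mulrBl -(zz_traversal_form ei) -(zz_traversal_form el) /zz_form.
  move: (zz_traversal_in_margin ei) (zz_traversal_in_margin el).
  rewrite /in_margin => /andP[/andP[a1 a2] /andP[a3 a4]] /andP[/andP[b1 b2] /andP[b3 b4]].
  rewrite opprD addrACA -!mulrBr; apply: lerD; apply: ler_wpM2l => //; lia.
rewrite zz_modulusE in idx_le.
rewrite -lez_nat PoszD !PoszM.
move: bound idx_le; move: (last i js - i) (route_length _) (size _) => D L S.
rewrite PoszM => bound idx_le.
have B_ge0 : (0 : int) <= (ball_size k)%:Z by [].
have := ler_wpM2l B_ge0 bound.
have K_ge0 : (0 : int) <= 14 * k%:Z by [].
have := ler_wpM2l K_ge0 idx_le.
by move: (Posz (ball_size k)) => B; lia.
Qed.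

End ZigzagPath.

(** * Bounds for every type *)

Lemma zigzag_in_rect k w h : all (in_rect w h) (route (zigzag_path k w h)).
Proof. by rewrite all_map; apply/allP => p _ /=; exact: project_in_rect. Qed.

(** Projection fixes [p] and is a contraction, so the nearby lattice point stays within [k] of
    [p]. *)
Lemma zigzag_covers k w h p : in_rect w h p ->
  exists2 F, F \in stops (zigzag_path k w h) & (l1dist p F <= k)%N.
Proof.
move=> p_in; have [q q_zz pq] := zz_lattice_near k p.
exists (project w h q); last first.
  by rewrite -{1}(project_id p_in) (leq_trans (project_contract _ _ _ _)).
apply: map_f; rewrite mem_alternate.
have q_in : q \in zz_traversal k w h (zz_index k q).
  rewrite mem_zz_traversal eqxx; apply/zz_pointsP; split=> //.
  by exists p.
apply/flatten_mapP; exists (zz_index k q) => //.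
by rewrite mem_indices; case: (zz_traversal _ _ _ _) q_in.
Qed.

Lemma zigzag_stop_count k w h :
  (size (stops (zigzag_path k w h)) <= size (zz_margin_points k w h))%N.
Proof.
rewrite size_map size_alternate -map_comp.
apply: (@leq_trans (size (zz_points k w h))); last first.
  by rewrite zz_points_filter size_filter count_size.
have js_uniq := undup_uniq [seq zz_index k p | p <- zz_points k w h].
rewrite -(sort_uniq <=%R) in js_uniq.
apply: leq_trans (sumn_count_classes _ _ js_uniq).
rewrite leq_eqVlt; apply/orP; left; apply/eqP; congr sumn; apply: eq_map => i /=.
by rewrite size_sort size_filter.
Qed.

Lemma zz_margin_points_bound k w h :
  (ball_size k * size (zz_margin_points k w h) <= (w + 4 * k).+1 * (h + 4 * k).+1)%N.
Proof.
apply: zz_packing; first exact: zz_margin_points_uniq.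
  by apply/allP => p; rewrite mem_zz_margin_points => /andP[].
by apply/allP => p; rewrite mem_zz_margin_points => /andP[].
Qed.

Lemma zigzag_route_length k w h : (0 < k)%N ->
  (ball_size k * route_length (route (zigzag_path k w h))
   <= k.*2.+1 * ((w + 20 * k) * (h + 20 * k)))%N.
Proof.
move=> k_gt0; apply: leq_trans (leq_mul (leqnn _) (route_length_map _ _)) _.
  exact: project_contract.
apply: leq_trans (zigzag_length_bound w h k_gt0) _.
have := zz_margin_points_bound k w h.
move: (_ * size _)%N => S S_le.
(* As k >= 1, 4k + 1 <= 5k. The linear terms then have coefficient 5 + 14 = 19 <= 20, and k^2 has 25
   + 56 = 81 <= 400. *)
apply: (@leq_trans (k.*2.+1 * ((w + 5 * k) * (h + 5 * k) + 14 * k * (w + h + 4 * k)))%N).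
  rewrite [X in (_ <= X)%N]mulnDr; apply: leq_add.
    by rewrite leq_mul2l /= (leq_trans S_le) // leq_mul; lia.
  have := leq_mul (leqnn (14 * k)) (_ : k * (w + k.*2) + k.+1 * (h + k.*2)
                                       <= k.*2.+1 * (w + h + 4 * k))%N.
  by rewrite mulnCA; apply; nia.
by rewrite leq_mul2l /=; nia.
Qed.

Lemma mem_types k d : (0 < k)%N -> d \in types k ->
  d = k.*2.+1 \/ [/\ (d == 1%N) || ~~ odd d, (0 < d <= k.*2)%N & d != k.*2.+1].
Proof.
move=> k_gt0; rewrite inE mem_rcons inE => /or3P[/eqP->|/eqP->|/mapP[i]].
- by right; split; lia.
- by left.
- by rewrite mem_iota => i_in ->; right; split; lia.
Qed.

(** One form for zigzag and vertical paths, so that the cost comparison need not distinguish them;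
    20 k absorbs all boundary effects. *)
Lemma up_and_down_bounds k d w h : (0 < k)%N -> d \in types k ->
  let U := up_and_down_path k d w h in
  [/\ all (in_rect w h) (route U), subseq (stops U) (route U),
      forall p, in_rect w h p -> exists2 F, F \in stops U & (l1dist p F <= k)%N,
      (gain k d * size (stops U) <= (w + 20 * k) * (h + 20 * k))%N
    & (gain k d * route_length (route U) <= d * ((w + 20 * k) * (h + 20 * k)))%N].
Proof.
move=> k_gt0 d_in U; rewrite /U /up_and_down_path.
have [->|[d_par d_le /negPf d_neq]] := mem_types k_gt0 d_in.
  rewrite eqxx gain_max; split.
  - exact: zigzag_in_rect.
  - exact: subseq_refl.
  - exact: zigzag_covers.
  - apply: (leq_trans (leq_mul (leqnn _) (zigzag_stop_count k w h))).
    apply: leq_trans (zz_margin_points_bound k w h) _.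
    by apply: leq_mul; lia.
  - exact: zigzag_route_length.
have /andP[d_gt0 d_le2] := d_le.
rewrite d_neq (gain_vertical d_par d_le2); set r := spacing k d.
have r_le : (r <= 3 * k)%N by rewrite /r /spacing; lia.
have tr_le := traversal_count_bound r w.
split.
- exact: vertical_route_in_rect.
- exact: vertical_stops_subseq.
- exact: vertical_covers.
- apply: (leq_trans (leq_mul (leqnn _) (vertical_stop_count k w h d_gt0))).
  have := leq_trunc_div h d; rewrite -/r.
  move: (traversal_count r w) (h %/ d)%N tr_le => t q tr_le qd_le.
  rewrite [X in (X <= _)%N](_ : _ = (t * r) * (q * d + 2 * d))%N; last by ring.
  by apply: leq_mul; lia.
apply: (leq_trans (leq_mul (leqnn _) (vertical_route_length k d w h))).
rewrite -mulnA leq_mul2l; apply/orP; right; rewrite -/r.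
by move: (traversal_count r w) tr_le => t tr_le; nia.
Qed.

(** * Single types as mixed paths *)

Lemma translate_x0 s : translate_x 0 s = s.
Proof. by rewrite /translate_x -[RHS]map_id; apply: eq_map => -[a b]; rewrite addr0. Qed.

Lemma infix_types k d : d \in types k -> d != k.*2.+1 ->
  exists d', infix [:: d; d'] (types k).
Proof.
move=> d_in d_neq.
have last_types : last 0%N (types k) = k.*2.+1 by rewrite /= last_rcons.
move: last_types; case/splitPr: d_in => p1 [|d' p2].
  by rewrite last_cat /= => d_eq; rewrite d_eq eqxx in d_neq.
by move=> _; exists d'; apply/infixP; exists p1, p2.
Qed.

Lemma infix_types_last k : exists d, infix [:: d; k.*2.+1] (types k).
Proof.
rewrite /types -rcons_cons; move: [seq _ | _ <- _] => t.
exists (last 1%N t); apply/infixP; exists (belast 1%N t), [::].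
by rewrite cats0 -cat_rcons -lastI cats1.
Qed.

(** A part of width 0 is absent. The type 2k + 1 comes last in [types k], so it is taken as the
    right part with gamma = 0; any other type is the left part with gamma = 1. *)
Lemma mixed_path_of_type (R : realType) n m k d : (0 < k)%N -> (0 < n)%N ->
  d \in types k ->
  exists P, [/\ is_mixed_path R n m k P,
                route P = route (up_and_down_path k d n m)
              & stops P = undup (stops (up_and_down_path k d n m))].
Proof.
move=> k_gt0 n_gt0 d_in.
have ceil_n : `|Num.ceil (n%:R : R)|%N = n by rewrite -[n%:R]/(n%:Z%:~R) intrKceil.
have ceil_0 : `|Num.ceil (0 : R)|%N = 0%N by rewrite ceil0.
have [d_eq|d_neq] := eqVneq d k.*2.+1.
  have [d' dd'] := infix_types_last k.
  exists (mixed_path n m k d' k.*2.+1 (0 : R)); split.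
  - by exists d', k.*2.+1, 0; split; rewrite ?lexx ?ler01.
  - rewrite /mixed_path mul0r subr0 mul1r ceil_n ceil_0 /part /= (gtn_eqF n_gt0) /=.
    by rewrite subrr translate_x0 d_eq.
  - rewrite /mixed_path mul0r subr0 mul1r ceil_n ceil_0 /part /= (gtn_eqF n_gt0) /=.
    by rewrite subrr translate_x0 d_eq.
have [d' dd'] := infix_types d_in d_neq.
exists (mixed_path n m k d d' (1 : R)); split.
- by exists d, d', 1; split; rewrite ?lexx ?ler01.
- rewrite /mixed_path mul1r subrr mul0r ceil_n ceil_0 /part /= (gtn_eqF n_gt0) /=.
  by rewrite translate_x0 cats0.
- rewrite /mixed_path mul1r subrr mul0r ceil_n ceil_0 /part /= (gtn_eqF n_gt0) /=.
  by rewrite translate_x0 cats0.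
Qed.

(** * Comparison of costs *)

Lemma exists_argmin (R : realType) (f : nat -> R) (s : seq nat) : s != [::] ->
  exists2 d, d \in s & {in s, forall d', f d <= f d'}.
Proof.
elim: s => [//|x s IHs] _; have [->|/IHs[d d_in d_min]] := eqVneq s [::].
  by exists x; rewrite ?mem_head // => d'; rewrite inE => /eqP->.
have [le_dx|/ltW le_xd] := leP (f d) (f x).
  exists d; first by rewrite inE d_in orbT.
  by move=> d'; rewrite inE => /orP[/eqP->|/d_min].
exists x; first exact: mem_head.
move=> d'; rewrite inE => /orP[/eqP->//|/d_min]; exact: le_trans.
Qed.

Lemma even_in_types k i : (0 < i <= k)%N -> i.*2 \in types k.
Proof.
move=> i_in; rewrite inE mem_rcons inE map_f ?orbT // mem_iota; lia.
Qed.

Lemma gain_gt0 k d : (0 < k)%N -> d \in types k -> (0 < gain k d)%N.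
Proof.
move=> k_gt0 /(mem_types k_gt0)[->|[d_par d_le d_neq]]; first by rewrite gain_max.
rewrite gain_vertical //; last by lia.
by rewrite muln_gt0 /spacing; lia.
Qed.

(* An even step [d] is available as a type.  An odd step [2 i + 1] strictly between
   [1] and [2 k + 1] is not, but its gain is at least [11] and exceeds the mean of
   the gains of its two neighbours by exactly [1]. *)
Lemma rate_step (R : realType) (k : nat) (lambda alpha beta : R) (d : nat) :
  (0 < k)%N -> 0 <= lambda -> 0 <= alpha -> 0 <= beta ->
  {in types k, forall d', lambda * (gain k d')%:R <= alpha * d'%:R + beta} ->
  (0 < d)%N ->
  lambda * (gain k (minn d k.*2.+1))%:R
  <= 11%:R / 10%:R * (alpha * d%:R + beta).
Proof.
move=> k_gt0 l_ge0 a_ge0 b_ge0 rate d_gt0.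
have cost_ge0 (e : nat) : 0 <= alpha * e%:R + beta by rewrite addr_ge0 ?mulr_ge0.
have of_types (e : nat) : e \in types k -> (e <= d)%N ->
    lambda * (gain k e)%:R <= 11%:R / 10%:R * (alpha * d%:R + beta).
  move=> /rate e_rate le_ed.
  have : alpha * e%:R <= alpha * d%:R by rewrite ler_wpM2l ?ler_nat.
  by have := cost_ge0 d; lra.
have [le_max|lt_max] := leqP k.*2.+1 d.
  by apply: of_types; rewrite // inE mem_rcons mem_head orbT.
have [even_d|odd_d] := boolP (~~ odd d).
  have d_eq : d = d./2.*2 by lia.
  by apply: of_types; rewrite // d_eq even_in_types //; lia.
have [d_eq1|d_neq1] := eqVneq d 1%N; first by apply: of_types; rewrite // d_eq1 mem_head.
set i := d./2; have d_eq : d = i.*2.+1 by rewrite /i; lia.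
have i_gt0 : (0 < i)%N by lia.
have i_lt : (i < k)%N by lia.
have gains : (gain k i.*2 + gain k i.+1.*2 + 2 = 2 * gain k i.*2.+1)%N.
  have g0 := gain_even (ltnW i_lt); have g1 := gain_odd (ltnW i_lt).
  have g2 := gain_even i_lt.
  move: g0 g1 g2; rewrite /ball_size -(subnK i_lt) addnS -addSn addnK.
  rewrite (_ : _ + i - i.+1 = k - i.+1)%N; last by lia.
  by move: (gain _ _) (gain _ _) (gain _ _) => x y z; nia.
(* The extreme case is k = 2 and d = 3, where the gain is exactly 11. *)
have gain_ge : (11 <= gain k i.*2.+1)%N.
  have := gain_odd (ltnW i_lt); rewrite /ball_size.
  have -> : k = (i + (k - i.+1)).+1 by lia.
  rewrite (_ : _ - i = (k - i.+1).+1)%N; last by lia.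
  by move: (k - i.+1)%N (gain _ _) => j x; nia.
have rate0 := rate _ (@even_in_types k i _).
have rate1 := rate _ (@even_in_types k i.+1 _).
have {rate0} rate0 : lambda * (gain k i.*2)%:R <= alpha * (2 * i%:R) + beta.
  by rewrite -natrM mul2n; apply: rate0; lia.
have {rate1} rate1 : lambda * (gain k i.+1.*2)%:R <= alpha * (2 * i%:R + 2) + beta.
  rewrite (_ : 2 * i%:R + 2 = i.+1.*2%:R :> R); first by apply: rate1; lia.
  by rewrite -mul2n natrM -[i.+1]addn1 natrD; ring.
have l_gain : lambda * 11%:R <= lambda * (gain k i.*2.+1)%:R.
  by rewrite ler_wpM2l // ler_nat.
have l_gains : lambda * (gain k i.*2)%:R + lambda * (gain k i.+1.*2)%:R + lambda * 2
               = 2 * (lambda * (gain k i.*2.+1)%:R).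
  by rewrite mulrCA -natrM -gains !natrD; ring.
have d_eqR : i.*2.+1%:R = 2 * i%:R + 1 :> R by rewrite -mul2n -addn1 natrD natrM.
(* Averaging the two neighbouring rates bounds [lambda] times (gain - 1) by the cost of the step,
   and gain - 1 is at least 10/11 of the gain. *)
by rewrite d_eq d_eqR; lra.
Qed.

Lemma sum_rate (R : realType) (k : nat) (lambda alpha beta : R) (ds : seq nat) :
  (0 < k)%N -> 0 <= lambda -> 0 <= alpha -> 0 <= beta ->
  {in types k, forall d', lambda * (gain k d')%:R <= alpha * d'%:R + beta} ->
  all (leq 1) ds ->
  lambda * (sumn [seq gain k (minn d k.*2.+1) | d <- ds])%:R
  <= 11%:R / 10%:R * (alpha * (sumn ds)%:R + beta * (size ds)%:R).
Proof.
move=> k_gt0 l_ge0 a_ge0 b_ge0 rate; elim: ds => [|d ds IHs] /=.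
  by rewrite !mulr0 addr0 mulr0.
move=> /andP[d_gt0 /IHs]; rewrite -[(size ds).+1]addn1 !natrD.
have := rate_step k_gt0 l_ge0 a_ge0 b_ge0 rate d_gt0; lra.
Qed.

(** [lambda] is a price per grid point not exceeding the rate of any type. The ball about the first
    stop is reached without a step, hence the subtracted term. *)
Lemma cost_lower_bound (R : realType) n m k (lambda alpha beta : R) Q :
  (0 < k)%N -> 0 <= lambda -> 0 <= alpha -> 0 <= beta ->
  {in types k, forall d, lambda * (gain k d)%:R <= alpha * d%:R + beta} ->
  covering_path n m k Q ->
  lambda * (n%:R * m%:R - (ball_size k)%:R)
  <= 11%:R / 10%:R * cost alpha beta (path_length Q) (stop_count Q).
Proof.
move=> k_gt0 l_ge0 a_ge0 b_ge0 rate /covering_gain[ds [points_le ds_ge1 len_le count_le]].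
have sum_le := sum_rate k_gt0 l_ge0 a_ge0 b_ge0 rate ds_ge1.
apply: (le_trans (_ : _ <= lambda * (sumn [seq gain k (minn d k.*2.+1) | d <- ds])%:R)).
  rewrite ler_wpM2l // lerBlDl -natrM -natrD ler_nat (leq_trans _ points_le) //.
  by apply: leq_mul.
apply: (le_trans sum_le); rewrite ler_wpM2l ?divr_ge0 // /cost.
by apply: lerD; rewrite ler_wpM2l // ler_nat // ltnW.
Qed.

Lemma ball_size_le k : (0 < k)%N -> (ball_size k <= 5 * (k * k))%N.
Proof. by rewrite /ball_size; nia. Qed.

Theorem theorem9 (R : realType) :
  exists c1 c2 : R, [/\ 0 < c1, 0 < c2 &
    forall (k m n : nat) (eps alpha beta : R),
      (1 <= k)%N -> (1 <= n)%N -> (n <= m)%N ->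
      0 < eps < 1 -> 0 <= alpha -> 0 <= beta ->
      c1 * (k%:R / eps) <= n%:R ->
      exists P : tour,
        [/\ is_mixed_path R n m k P,
            covering_path n m k P
          & forall Q : tour, covering_path n m k Q ->
              cost alpha beta (path_length P) (stop_count P)
              <= (11%:R / 10%:R + c2 * eps)
                   * cost alpha beta (path_length Q) (stop_count Q)]].
Proof.
(* 20 matches the boundary term 20 k of [up_and_down_bounds]. The final factor 11/10 (1 + 5 eps) =
   11/10 + 5.5 eps leaves room below 8. *)
exists 20, 8; split=> // k m n eps alpha beta k_gt0 n_gt0 le_nm.
move=> /andP[eps_gt0 eps_lt1] a_ge0 b_ge0 n_large.
have k_small : 20 * k%:R <= eps * n%:R.
  by rewrite [eps * _]mulrC -ler_pdivrMr // -mulrA.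
have [d d_in d_min] := @exists_argmin R
  (fun d => (alpha * d%:R + beta) / (gain k d)%:R) (types k) isT.
set lambda := (alpha * d%:R + beta) / (gain k d)%:R in d_min.
have gain_pos d' : d' \in types k -> 0 < (gain k d')%:R :> R.
  by move=> d'_in; rewrite ltr0n gain_gt0.
have l_ge0 : 0 <= lambda by rewrite divr_ge0 ?addr_ge0 ?mulr_ge0.
have rate : {in types k, forall d', lambda * (gain k d')%:R <= alpha * d'%:R + beta}.
  by move=> d' d'_in; rewrite -ler_pdivlMr ?gain_pos // d_min.
have [P [P_mixed P_route P_stops]] := @mixed_path_of_type R n m k d k_gt0 n_gt0 d_in.
have [U_rect U_sub U_cover U_count U_length] := @up_and_down_bounds k d n m k_gt0 d_in.
exists P; split=> // [|Q Q_cover].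
  split; rewrite ?P_route ?P_stops ?undup_uniq //.
    exact: subseq_trans (undup_subseq _) U_sub.
  by move=> p /U_cover[F F_in pF]; exists F; rewrite ?mem_undup.
have lower := cost_lower_bound k_gt0 l_ge0 a_ge0 b_ge0 rate Q_cover.
set A : R := (n%:R + 20 * k%:R) * (m%:R + 20 * k%:R).
have upper : cost alpha beta (path_length P) (stop_count P) <= lambda * A.
  have AE : ((n + 20 * k) * (m + 20 * k))%:R = A.
    by rewrite natrM (natrD _ n) (natrD _ m) !natrM.
  have lenP : (gain k d)%:R * (path_length P)%:R <= d%:R * A.
    by rewrite -AE -!natrM ler_nat /path_length P_route.
  have countP : (gain k d)%:R * (stop_count P)%:R <= A.
    rewrite -AE -natrM ler_nat /stop_count P_stops (leq_trans _ U_count) //.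
    by rewrite leq_mul2l size_undup orbT.
  rewrite /lambda mulrAC ler_pdivlMr ?gain_pos // /cost.
  have := ler_wpM2l a_ge0 lenP; have := ler_wpM2l b_ge0 countP; lra.
have nm : n%:R <= m%:R :> R by rewrite ler_nat.
have k_ge1 : 1 <= k%:R :> R by rewrite ler1n.
have n_ge1 : 1 <= n%:R :> R by rewrite ler1n.
have ball_le : (ball_size k)%:R <= 5 * (k%:R * k%:R) :> R.
  by have := ball_size_le k_gt0; rewrite -(ler_nat R) (natrM _ 5) (natrM _ k).
set cQ := cost _ _ (path_length Q) _ in lower *.
set cP := cost _ _ (path_length P) _ in upper *.
set B : R := n%:R * m%:R in lower.
have A_le : A <= (1 + eps) * (1 + eps) * B.
  rewrite /A /B mulrACA; apply: ler_pM; rewrite ?addr_ge0 ?mulr_ge0 //; nra.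
have kk_le : 400 * (k%:R * k%:R) <= eps * B.
  have : (20 * k%:R) * (20 * k%:R) <= (eps * n%:R) * m%:R.
    apply: ler_pM; rewrite ?mulr_ge0 //; nra.
  by rewrite /B; lra.
have B_ge0 : 0 <= B by rewrite mulr_ge0.
have lB_ge0 : 0 <= lambda * B by rewrite mulr_ge0.
have cP_le : cP <= (1 + eps) * (1 + eps) * (lambda * B).
  have -> : (1 + eps) * (1 + eps) * (lambda * B) = lambda * ((1 + eps) * (1 + eps) * B).
    by ring.
  by apply: (le_trans upper); rewrite ler_wpM2l.
(* The first ball has at most 5 k^2 points and 400 k^2 <= eps n m, so it takes at most the fraction
   eps / 80 of n m. *)
have cQ_ge : (1 - eps / 80) * (lambda * B) <= 11%:R / 10%:R * cQ.
  have -> : (1 - eps / 80) * (lambda * B) = lambda * ((1 - eps / 80) * B) by ring.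
  apply: le_trans lower; rewrite ler_wpM2l //; lra.
have key : (1 + eps) * (1 + eps) <= (1 + 5 * eps) * (1 - eps / 80) by nra.
have : cP <= (1 + 5 * eps) * (11%:R / 10%:R * cQ).
  apply: (le_trans cP_le); apply: (le_trans (ler_wpM2r lB_ge0 key)).
  by rewrite -[_ * _ * (lambda * B)]mulrA ler_wpM2l //; lra.
have cQ_ge0 : 0 <= cQ by rewrite addr_ge0 ?mulr_ge0.
have : 0 <= eps * cQ by rewrite mulr_ge0 // ltW.
lra.
Qed.
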